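(* Consider the DC/AC converter $$C_{dc}\dot v_{dc}=-G_{dc}v_{dc}+i_{dc}-\tfrac12m_{\alpha\beta}^\top i_{\alpha\beta},\qquad C\,\dot v_{\alpha\beta}=-i_{load}+i_{\alpha\beta},\qquad L\,\dot i_{\alpha\beta}=-R\,i_{\alpha\beta}+\tfrac12m_{\alpha\beta}v_{dc}-v_{\alpha\beta}$$ with the modulation control $$\dot\xi=\eta\,v_{dc}\begin{bmatrix}0&-1\\1&0\end{bmatrix}\xi,\qquad m_{\alpha\beta}=\mu\,\xi,\qquad \|\xi(0)\|_2=1 .$$ The closed-loop system is passive with respect to the input $u=\begin{bmatrix}i_{dc}&-i_{load}^\top\end{bmatrix}^\top$ and the output $y=\begin{bmatrix}v_{dc}&v_{\alpha\beta}^\top\end{bmatrix}^\top$.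
   Context: $v_{dc}(t)\in\mathbb R$ and $v_{\alpha\beta}(t),i_{\alpha\beta}(t),\xi(t)\in\mathbb R^2$ are the states; $i_{dc}(t)\in\mathbb R$ and $i_{load}(t)\in\mathbb R^2$ are inputs; $C_{dc},G_{dc},C,L,R,\eta>0$ and $\mu\in(0,1]$ are constants. A system with state $x$, input $u$ and output $y$ is passive if there is a continuously differentiable storage function $S(x)\ge0$ with $\dot S\le u^\top y$ along all trajectories. *)

(* Defs.v *)
From HB Require Import structures.
From mathcomp Require Import all_boot all_order all_algebra.
From mathcomp Require Import all_classical all_reals all_analysis.
Set Implicit Arguments.
Unset Strict Implicit.
Unset Printing Implicit Defensive.
Import Order.TTheory GRing.Theory Num.Theory.
Import numFieldNormedType.Exports.
Local Open Scope classical_set_scope.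
Local Open Scope ring_scope.

(* Derivative at [t] relative to a time domain [J]: two-sided in the interior
   of [J], one-sided at an endpoint belonging to [J]. *)
Definition has_derivative_on (R : realType) (V : normedModType R)
    (J : set R) (f : R -> V) (t : R) (l : V) : Prop :=
  (s - t)^-1 *: (f s - f t) @[s --> within J t^'] --> l.

(* Fréchet differentiable everywhere, with [x |-> 'd S x] continuous for the
   operator norm. *)
Definition continuously_differentiable (R : realType) (X : normedModType R)
    (S : X -> R) : Prop :=
  (forall x, differentiable S x) /\
  (forall x (e : R), 0 < e -> \forall z \near x,
     forall v, `|'d S z v - 'd S x v| <= e * `|v|).

(* [dynamics x u dx] is the (possibly implicit) differential equation relating
   the state, the input and the time derivative of the state; input and output
   have the same dimension [p]. *)
Record io_system (R : realType) (X : normedModType R) (p : nat) := IOSystem {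
  dynamics : X -> 'cV[R]_p -> X -> Prop;
  initial : set X;
  output : X -> 'cV[R]_p
}.

(* No regularity is imposed on the input signal [u] beyond the existence of
   the solution [x]. *)
Definition trajectory (R : realType) (X : normedModType R) (p : nat)
    (sys : io_system X p) (T : R) (u : R -> 'cV[R]_p) (x : R -> X) : Prop :=
  initial sys (x 0) /\
  forall t : R, t \in `[0, T[ -> exists dx : X,
    has_derivative_on `[0, T[ x t dx /\ dynamics sys (x t) (u t) dx.

(* Restricting to bounded horizons loses nothing: a solution on [0, +oo[ is a
   solution on every [0, T[. *)
Definition passive (R : realType) (X : normedModType R) (p : nat)
    (sys : io_system X p) : Prop :=
  exists S : X -> R,
    [/\ continuously_differentiable S,
        forall x, 0 <= S x &
        forall (T : R) (u : R -> 'cV[R]_p) (x : R -> X),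
          0 < T -> trajectory sys T u x ->
          forall t : R, t \in `[0, T[ -> exists dS : R,
            has_derivative_on `[0, T[ (S \o x) t dS /\
            dS <= ((u t)^T *m output sys (x t)) 0 0].

(* The library norm `|_| on matrices is the sup norm. *)
Definition norm2 (R : realType) (n : nat) (v : 'cV[R]_n) : R :=
  Num.sqrt (\sum_(i < n) v i 0 ^+ 2).

Definition rot90 (R : realType) : 'M[R]_2 :=
  block_mx (0%:M : 'M[R]_1) (-1)%:M 1%:M 0%:M.

(* State (v_dc, v_ab, i_ab, xi). *)
Definition converter_state (R : realType) : normedModType R :=
  (R * 'cV[R]_2 * 'cV[R]_2 * 'cV[R]_2)%type.

Definition converter_dynamics (R : realType) (Cdc Gdc C L r eta mu : R)
    (x : converter_state R) (u : 'cV[R]_(1 + 2)) (dx : converter_state R)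
    : Prop :=
  let: (v_dc, v_ab, i_ab, xi) := x in
  let: (dv_dc, dv_ab, di_ab, dxi) := dx in
  let m_ab := mu *: xi in
  exists (i_dc : R) (i_load : 'cV[R]_2),
    u = col_mx i_dc%:M (- i_load) /\
    [/\ Cdc * dv_dc = - Gdc * v_dc + i_dc - 2^-1 * (m_ab^T *m i_ab) 0 0,
        C *: dv_ab = - i_load + i_ab,
        L *: di_ab = - (r *: i_ab) + (2^-1 * v_dc) *: m_ab - v_ab &
        dxi = (eta * v_dc) *: (rot90 R *m xi)].

Definition converter_output (R : realType) (x : converter_state R)
    : 'cV[R]_(1 + 2) :=
  let: (v_dc, v_ab, _, _) := x in col_mx v_dc%:M v_ab.

Definition converter (R : realType) (Cdc Gdc C L r eta mu : R)
    : io_system (converter_state R) (1 + 2) :=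
  {| dynamics := converter_dynamics Cdc Gdc C L r eta mu;
     initial := [set x | let: (_, _, _, xi) := x in norm2 xi = 1];
     output := @converter_output R |}.

(* Main.v *)
Require Import Defs.
From HB Require Import structures.
From mathcomp Require Import all_boot all_order all_algebra.
From mathcomp Require Import all_classical all_reals all_analysis.
From mathcomp Require Import ring.
Import Order.TTheory GRing.Theory Num.Theory.
Import numFieldNormedType.Exports.
Local Open Scope classical_set_scope.
Local Open Scope ring_scope.

(** The storage function is the physical energy of the converter,
      S = (Cdc v_dc^2 + C |v_ab|^2 + L |i_ab|^2) / 2,
    stored in the two capacitors and in the inductor.
    Along a solution its derivative is
      v_dc (Cdc v_dc') + v_ab . (C v_ab') + i_ab . (L i_ab'),
    and substituting the three circuit equations makes the interconnection
    terms cancel in pairs: v_dc m_ab . i_ab / 2 leaves the DC side and enters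
    the inductor, v_ab . i_ab leaves the inductor and enters the AC capacitor.
    What remains is the supplied power u . y minus the losses
    Gdc v_dc^2 + r |i_ab|^2 (lemma [energy_rate]). The cancellation holds for
    every modulation signal m_ab, because the converter bridge is lossless.

    The analytic part is about an arbitrary continuous symmetric bilinear form
    B: the function B x x / 2 has differential B x, which depends on x in a
    Lipschitz way, and its derivative along a curve x is B (x t) (x' t). The
    energy is the instance where B is [energy_form]. *)

(** In a normed module over the reals, scaling of a real number and
    multiplication are convertible but not syntactically equal; [ring] and
    [field] recognize only the latter. *)
Lemma scale_realE (R : realType) (a b : R) : a *: b = a * b.
Proof. by []. Qed.

Definition half_square {R : realType} {X : normedModType R}
    (B : X -> X -> R) (x : X) : R := 2^-1 * B x x.

Section HalfSquare.
Context {R : realType} {X : normedModType R}.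
Context (B : {bilinear X -> X -> R}).
Context (B_sym : forall x y, B x y = B y x).
Context (B_cont : continuous (fun p : X * X => B p.1 p.2)).

(** By the product rule for bilinear maps composed with the diagonal, the
    differential at [x] is [(B x y + B y x) / 2], which symmetry collapses. *)
Lemma is_diff_half_square (x : X) :
  is_diff x (half_square B : X -> R) (B x : X -> R).
Proof.
have dB : is_diff (x, x) (fun p : X * X => B p.1 p.2)
    (fun q => B x q.2 + B q.1 x : R).
  apply: DiffDef; first exact: differentiable_bilin.
  exact: diff_bilin.
have -> : half_square B =
    (2^-1 : R) *: ((fun p : X * X => B p.1 p.2) \o (fun y => (y, y))) by [].
apply: is_diff_eq; apply/funext => y /=.
change (2^-1 * (B x y + B y x) = B x y).
by rewrite [B y x]B_sym; field.
Qed.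

(** The differential is itself linear in the base point, so the difference of
    the differentials at [z] and [x] is [B (z - x)], whose operator norm is at
    most [k * `|z - x|] for a bound [k] of [B]. *)
Lemma continuously_differentiable_half_square :
  continuously_differentiable (half_square B).
Proof.
split=> [x|x e e_gt0].
  exact: (@ex_diff _ _ _ _ _ _ _ (is_diff_half_square x)).
have [k k_gt0 Bk] := bilinear_schwarz B_cont.
near=> z => v.
rewrite (@diff_val _ _ _ _ _ _ _ (is_diff_half_square z)).
rewrite (@diff_val _ _ _ _ _ _ _ (is_diff_half_square x)).
rewrite -linearBl (le_trans (Bk _ _))// ler_wpM2r//.
rewrite -ler_pdivlMl// distrC ltW//.
by near: z; apply: cvgr_dist_lt => //; rewrite mulr_gt0 ?invr_gt0.
Unshelve. all: by end_near. Qed.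

(** The polarization identity
      B y y - B x x = 2 B x (y - x) + B (y - x) (y - x)
    writes the difference quotient of [half_square B \o x] as a continuous
    expression in the difference quotient [q] of [x], with no remainder term to
    estimate. This works for any time domain [J], so one-sided derivatives at
    endpoints need no separate treatment. *)
Lemma has_derivative_on_half_square (J : set R) (x : R -> X) (t : R) (dx : X) :
  has_derivative_on J x t dx ->
  has_derivative_on J (half_square B \o x) t (B (x t) dx : R).
Proof.
rewrite /has_derivative_on; set q := (X in X @ _ --> _) => qdx.
have -> : (fun s =>
    (s - t)^-1 *: ((half_square B \o x) s - (half_square B \o x) t)) =
    (fun s => B (x t) (q s) + 2^-1 * ((s - t) * B (q s) (q s)) : R).
  apply/funext => s; rewrite /half_square /q !scale_realE.
  have [->|st] := eqVneq s t.
    by rewrite /= !subrr scaler0 !mulr0 linear0r mul0r mulr0 addr0.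
  have st0 : s - t != 0 by rewrite subr_eq0.
  have -> : B (x t) ((s - t)^-1 *: (x s - x t)) =
      (s - t)^-1 * (B (x s) (x t) - B (x t) (x t)) :> R.
    by rewrite linearZr_LR linearBr [B (x t) (x s)]B_sym.
  have -> : B ((s - t)^-1 *: (x s - x t)) ((s - t)^-1 *: (x s - x t)) =
      (s - t)^-1 * ((s - t)^-1 *
        (B (x s) (x s) - B (x s) (x t) - (B (x s) (x t) - B (x t) (x t)))) :> R.
    by rewrite linearZr_LR linearZl_LR linearBr !linearBl [B (x t) (x s)]B_sym.
  by rewrite /=; field.
have Bq (y : R -> X) l : y s @[s --> within J t^'] --> l ->
    B (y s) (q s) @[s --> within J t^'] --> B l dx.
  move=> yl; apply: (@cvg_comp _ _ _ (fun s => (y s, q s)) (fun p => B p.1 p.2)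
    _ (nbhs (l, dx)) _ _ (B_cont _)).
  exact: cvg_pair.
(* The second summand is the limit of the quadratic term, which vanishes. *)
have -> : B (x t) dx = B (x t) dx + 2^-1 * ((t - t) * B dx dx) :> R.
  by rewrite subrr mul0r mulr0 addr0.
apply: cvgD; first by apply: Bq; exact: cvg_cst.
apply: cvgM; first exact: cvg_cst.
apply: cvgM; last exact: Bq.
apply: cvgB; last exact: cvg_cst.
apply: cvg_trans (cvg_within _) _.
exact: nbhs_dnbhs.
Qed.

End HalfSquare.

Definition dot {R : realType} {n : nat} (v w : 'cV[R]_n) : R := (v^T *m w) 0 0.

Lemma dotE (R : realType) n (v w : 'cV[R]_n) :
  dot v w = \sum_i v i 0 * w i 0.
Proof. by rewrite /dot mxE; apply: eq_bigr => i _; rewrite mxE. Qed.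

Lemma dotC (R : realType) n (v w : 'cV[R]_n) : dot v w = dot w v.
Proof. by rewrite !dotE; apply: eq_bigr => i _; rewrite mulrC. Qed.

Lemma dotDr (R : realType) n (v u w : 'cV[R]_n) :
  dot v (u + w) = dot v u + dot v w.
Proof. by rewrite /dot mulmxDr mxE. Qed.

Lemma dotZr (R : realType) n a (v w : 'cV[R]_n) : dot v (a *: w) = a * dot v w.
Proof. by rewrite /dot -scalemxAr mxE. Qed.

Lemma dotNr (R : realType) n (v w : 'cV[R]_n) : dot v (- w) = - dot v w.
Proof. by rewrite /dot mulmxN mxE. Qed.

Lemma dot_ge0 (R : realType) n (v : 'cV[R]_n) : 0 <= dot v v.
Proof. by rewrite dotE sumr_ge0// => i _; rewrite -expr2 sqr_ge0. Qed.

Lemma cvg_dot (R : realType) n (T : Type) (F : set_system T) (FF : Filter F)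
    (f g : T -> 'cV[R]_n) v w :
  f @ F --> v -> g @ F --> w -> dot (f x) (g x) @[x --> F] --> dot v w.
Proof.
move=> fv gw; rewrite dotE; under eq_cvg do rewrite dotE.
apply: cvg_big => [|i _]; first exact: add_continuous.
apply: cvgM.
  exact: (@cvg_comp _ _ _ _ _ _ _ _ fv (@coord_continuous _ _ _ i 0 v)).
exact: (@cvg_comp _ _ _ _ _ _ _ _ gw (@coord_continuous _ _ _ i 0 w)).
Qed.

Lemma cvg_comp_fst (T : Type) (F : set_system T) (U V : topologicalType)
    (f : T -> U * V) (l : U * V) : f @ F --> l -> (f x).1 @[x --> F] --> l.1.
Proof.
case: l => u v fl.
exact: (@cvg_comp _ _ _ f fst _ (nbhs (u, v)) (nbhs u) fl cvg_fst).
Qed.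

Lemma cvg_comp_snd (T : Type) (F : set_system T) (U V : topologicalType)
    (f : T -> U * V) (l : U * V) : f @ F --> l -> (f x).2 @[x --> F] --> l.2.
Proof.
case: l => u v fl.
exact: (@cvg_comp _ _ _ f snd _ (nbhs (u, v)) (nbhs v) fl cvg_snd).
Qed.

Section Converter.
Context {R : realType} (Cdc C L : R).

(** The symmetric bilinear form polarizing twice the stored energy. It is
    degenerate: the component [xi] of the state stores no energy. *)
Definition energy_form (x y : converter_state R) : R :=
  Cdc * (x.1.1.1 * y.1.1.1) + C * dot x.1.1.2 y.1.1.2 + L * dot x.1.2 y.1.2.

Lemma energy_formC x y : energy_form x y = energy_form y x.
Proof.
by rewrite /energy_form [x.1.1.1 * _]mulrC [dot x.1.1.2 _]dotC [dot x.1.2 _]dotC.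
Qed.

Lemma energy_form_is_bilinear :
  bilinear_for (GRing.Scale.Law.clone _ _ *:%R _)
    (GRing.Scale.Law.clone _ _ *:%R _) energy_form.
Proof.
have lin x : linear (energy_form x).
  by move=> a u v; rewrite /energy_form /= !dotDr !dotZr !scale_realE; ring.
split=> // y a u v.
rewrite /= ![energy_form _ y]energy_formC; exact: lin.
Qed.

HB.instance Definition _ := bilinear_isBilinear.Build R
  (converter_state R) (converter_state R) R _ _ energy_form
  energy_form_is_bilinear.

Lemma energy_form_continuous :
  continuous (fun p : converter_state R * converter_state R =>
    energy_form p.1 p.2).
Proof.
move=> p; rewrite /continuous_at /energy_form.
apply: cvgD; first apply: cvgD; apply: cvgM; try exact: cvg_cst.
- by apply: cvgM; do 3!apply: cvg_comp_fst;
    [apply: cvg_comp_fst|apply: cvg_comp_snd]; exact: cvg_id.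
- by apply: cvg_dot; apply: cvg_comp_snd; do 2!apply: cvg_comp_fst;
    [apply: cvg_comp_fst|apply: cvg_comp_snd]; exact: cvg_id.
- by apply: cvg_dot; apply: cvg_comp_snd; apply: cvg_comp_fst;
    [apply: cvg_comp_fst|apply: cvg_comp_snd]; exact: cvg_id.
Qed.

End Converter.

Lemma energy_form_ge0 {R : realType} (Cdc C L : R) (x : converter_state R) :
  0 <= Cdc -> 0 <= C -> 0 <= L -> 0 <= energy_form Cdc C L x x.
Proof.
move=> ? ? ?; rewrite /energy_form -expr2.
by rewrite !addr_ge0// mulr_ge0// ?sqr_ge0// dot_ge0.
Qed.

(** The power balance: the energy changes at the rate of the supplied power
    minus the dissipation in the conductance and in the resistance. The terms
    that carry [mu *: xi] occur once with each sign, as the power leaving the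
    DC side and the power entering the inductor. *)
Lemma energy_rate {R : realType} (Cdc Gdc C L r eta mu : R)
    (x : converter_state R) (u : 'cV[R]_(1 + 2)) (dx : converter_state R) :
  converter_dynamics Cdc Gdc C L r eta mu x u dx ->
  energy_form Cdc C L x dx = dot u (converter_output x)
    - (Gdc * x.1.1.1 ^+ 2 + r * dot x.1.2 x.1.2).
Proof.
case: x => [[[v vab] i] xi]; case: dx => [[[dv dvab] di] dxi].
move=> [idc [iload [-> [Edv Edvab Edi _]]]]; rewrite /energy_form /=.
have -> : C * dot vab dvab = dot vab i - dot iload vab.
  by rewrite -dotZr Edvab addrC dotDr dotNr [dot vab iload]dotC.
have -> : L * dot i di = - (r * dot i i)
    + 2^-1 * v * dot (mu *: xi) i - dot vab i.
  rewrite -dotZr Edi !dotDr !dotNr !dotZr.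
  by rewrite [dot (mu *: xi) i]dotC [dot vab i]dotC dotZr.
have -> : dot (col_mx idc%:M (- iload) : 'cV[R]_(1 + 2)) (col_mx v%:M vab) =
    idc * v - dot iload vab.
  rewrite /dot tr_col_mx mul_row_col mxE tr_scalar_mx -scalar_mxM.
  by rewrite linearN mulNmx !mxE.
by rewrite mulrCA Edv -/(dot _ _); ring.
Qed.

Theorem lemma5p4p2 (R : realType) (Cdc Gdc C L r eta mu : R)
    (Cdc_gt0 : 0 < Cdc) (Gdc_gt0 : 0 < Gdc) (C_gt0 : 0 < C) (L_gt0 : 0 < L)
    (r_gt0 : 0 < r) (eta_gt0 : 0 < eta) (mu_gt0 : 0 < mu) (mu_le1 : mu <= 1) :
  passive (converter Cdc Gdc C L r eta mu).
Proof.
exists (half_square (energy_form Cdc C L)); split.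
- apply: continuously_differentiable_half_square.
  + exact: energy_formC.
  + exact: energy_form_continuous.
- by move=> x; rewrite mulr_ge0// ?invr_ge0// energy_form_ge0 ?ltW.
move=> T u x T_gt0 [_ sol] t /sol [dx [dxt dyn]].
exists (energy_form Cdc C L (x t) dx); split.
  apply: has_derivative_on_half_square dxt.
  + exact: energy_formC.
  + exact: energy_form_continuous.
rewrite (energy_rate _ _ _ _ _ _ _ _ _ _ dyn) gerBl.
by rewrite addr_ge0// mulr_ge0 ?sqr_ge0 ?dot_ge0// ltW.
Qed.
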